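(* Fix $\alpha\in(0,1)$ and the model parameters and demands described in the context, and let $\beta^{\mathrm{SO}}$ be a system optimum. Let the toll $\tau_p\in\mathbb{R}$ for pool ride-hailing users utilizing the bus lanes be $$\tau_p=-t_f ab\left(\frac{x^{pv}+(1-\beta^{\mathrm{SO}})x^{rs}}{\omega\alpha C}\right)^b+\frac{t_f abk}{o^p(1-\alpha)C}\left(\frac{\beta^{\mathrm{SO}}\frac{x^{rs}}{o^p}+f_b}{(1-\alpha)C}\right)^{b-1}\left(\beta^{\mathrm{SO}}x^{rs}\Delta_p+x^b\Delta_b\right).$$ Then the socially optimal solution is achieved, i.e. the user equilibrium with toll $\tau_p$ is equal to $\beta^{\mathrm{SO}}$.
   Context: Parameters: $t_f>0$, $C>0$, $a>0$, $b>0$, $o^p>1$ (pool occupancy), $\Delta_p>1$, $\Delta_b>1$ (detour factors), $\gamma>0$. Demands: private vehicles $x^{pv}>0$, ride-hailing $x^{rs}>0$, bus users $x^b>0$, and bus flow $f_b>0$ with $f_b<x^b$. The constant $\omega=\omega(n_e)\in(0,1]$ is fixed (capacity reduction due to a fixed number $n_e\ge 0$ of empty vehicles). The constant $k=k(f_b)$ is the value at $f_b$ of a continuously differentiable function $k:[0,\infty)\to(0,\infty)$ with $k'>0$ and $k(0)>1$; in particular $k>1$. The space split is $\alpha\in(0,1)$: a fraction $\alpha$ goes to the vehicle network and $1-\alpha$ to the bus network. Delay functions, for solo demand $x^s\ge 0$ and pool demand $x^p\ge 0$: $$t_{\mathcal V}(x^s)=t_f\left(1+a\left(\frac{x^{pv}+x^s}{\omega\alpha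 C}\right)^b\right),\qquad t_{\mathcal B}(x^p)=t_f\left(1+a\left(\frac{\frac{x^p}{o^p}+f_b}{(1-\alpha)C}\right)^b\right)\Delta_p k,$$ $$t_b(x^p)=t_f\left(1+a\left(\frac{\frac{x^p}{o^p}+f_b}{(1-\alpha)C}\right)^b\right)\Delta_b k+\gamma .$$ For $\beta\in[0,1]$ (the fraction of ride-hailing users who pool), the total passenger hours travelled are $$\mathrm{PHT}(\beta)=x^{pv}t_{\mathcal V}((1-\beta)x^{rs})+(1-\beta)x^{rs}t_{\mathcal V}((1-\beta)x^{rs})+\beta x^{rs}t_{\mathcal B}(\beta x^{rs})+x^b t_b(\beta x^{rs}).$$ A system optimum is any $\beta^{\mathrm{SO}}\in\operatorname*{arg\,min}_{\beta\in[0,1]}\mathrm{PHT}(\beta)$. The toll is additive to the pool delay function: the user (Wardrop) equilibrium with toll $\tau_p$ is the unique minimizer $$\beta^{\mathrm{UE}}\in\operatorname*{arg\,min}_{\beta\in[0,1]}\int_0^{(1-\beta)x^{rs}}t_{\mathcal V}(s)\,ds+\int_0^{\beta x^{rs}}\left(t_{\mathcal B}(s)+\tau_p\right)ds .$$ *)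

(* Defs.v *)
From Stdlib Require Import Reals.
From Coquelicot Require Import Coquelicot.
Open Scope R_scope.

Record model := Model {
  t_f : R;              (* free-flow travel time *)
  cap : R;              (* total road capacity, shared as alpha and 1 - alpha *)
  bpr_a : R;            (* coefficient a of the delay functions *)
  bpr_b : R;            (* exponent b of the delay functions *)
  o_p : R;              (* pool occupancy *)
  Delta_p : R;          (* detour factor of pool vehicles *)
  Delta_b : R;          (* detour factor of buses *)
  gamma : R;            (* additive constant of the bus delay *)
  x_pv : R;             (* private-vehicle demand *)
  x_rs : R;             (* ride-hailing demand *)
  x_b : R;              (* bus users *)
  f_b : R;              (* bus flow *)
  n_e : R;              (* number of empty vehicles *)
  omega_fun : R -> R;   (* capacity reduction due to empty vehicles *)
  k_fun : R -> R        (* slowdown factor due to buses, meaningful on [0, oo) *)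
}.

Definition omega (m : model) : R := omega_fun m (n_e m).
Definition k (m : model) : R := k_fun m (f_b m).

Definition half_line (x : R) : Prop := 0 <= x.

(* k : [0, oo) -> (0, oo) is C^1 with k' > 0 and k(0) > 1. Both the derivative
   and its continuity are relative to [0, oo), hence one-sided at 0. *)
Definition bus_factor (kf : R -> R) : Prop :=
  1 < kf 0 /\
  (forall x, 0 <= x -> 0 < kf x) /\
  exists kf' : R -> R, forall x, 0 <= x ->
    D_in kf kf' half_line x /\ continue_in kf' half_line x /\ 0 < kf' x.

Record admissible (m : model) : Prop := Admissible {
  t_f_gt0 : 0 < t_f m;
  cap_gt0 : 0 < cap m;
  bpr_a_gt0 : 0 < bpr_a m;
  bpr_b_gt0 : 0 < bpr_b m;
  o_p_gt1 : 1 < o_p m;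
  Delta_p_gt1 : 1 < Delta_p m;
  Delta_b_gt1 : 1 < Delta_b m;
  gamma_gt0 : 0 < gamma m;
  x_pv_gt0 : 0 < x_pv m;
  x_rs_gt0 : 0 < x_rs m;
  x_b_gt0 : 0 < x_b m;
  f_b_gt0 : 0 < f_b m;
  f_b_lt_x_b : f_b m < x_b m;
  n_e_ge0 : 0 <= n_e m;
  omega_range : 0 < omega m <= 1;
  k_fun_bus_factor : bus_factor (k_fun m)
}.

(* For nonnegative demands every base of [Rpower] below is positive, because
   x_pv, f_b > 0, so [Rpower] is the usual real power there. *)

Definition load_V (m : model) (alpha xs : R) : R :=
  (x_pv m + xs) / (omega m * alpha * cap m).

Definition load_B (m : model) (alpha xp : R) : R :=
  (xp / o_p m + f_b m) / ((1 - alpha) * cap m).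

Definition t_V (m : model) (alpha xs : R) : R :=
  t_f m * (1 + bpr_a m * Rpower (load_V m alpha xs) (bpr_b m)).

Definition t_B (m : model) (alpha xp : R) : R :=
  t_f m * (1 + bpr_a m * Rpower (load_B m alpha xp) (bpr_b m))
  * Delta_p m * k m.

Definition t_b (m : model) (alpha xp : R) : R :=
  t_f m * (1 + bpr_a m * Rpower (load_B m alpha xp) (bpr_b m))
  * Delta_b m * k m + gamma m.

Definition PHT (m : model) (alpha beta : R) : R :=
  x_pv m * t_V m alpha ((1 - beta) * x_rs m)
  + (1 - beta) * x_rs m * t_V m alpha ((1 - beta) * x_rs m)
  + beta * x_rs m * t_B m alpha (beta * x_rs m)
  + x_b m * t_b m alpha (beta * x_rs m).

Definition beckmann (m : model) (alpha tau beta : R) : R :=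
  RInt (fun s => t_V m alpha s) 0 ((1 - beta) * x_rs m)
  + RInt (fun s => t_B m alpha s + tau) 0 (beta * x_rs m).

Definition is_argmin01 (F : R -> R) (beta : R) : Prop :=
  0 <= beta <= 1 /\ forall beta', 0 <= beta' <= 1 -> F beta <= F beta'.

Definition system_optimum (m : model) (alpha beta : R) : Prop :=
  is_argmin01 (PHT m alpha) beta.

Definition user_equilibrium (m : model) (alpha tau beta : R) : Prop :=
  is_argmin01 (beckmann m alpha tau) beta.

Definition pool_toll (m : model) (alpha beta : R) : R :=
  - (t_f m * bpr_a m * bpr_b m
     * Rpower ((x_pv m + (1 - beta) * x_rs m) / (omega m * alpha * cap m))
              (bpr_b m))
  + t_f m * bpr_a m * bpr_b m * k m / (o_p m * (1 - alpha) * cap m)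
    * Rpower ((beta * (x_rs m / o_p m) + f_b m) / ((1 - alpha) * cap m))
             (bpr_b m - 1)
    * (beta * x_rs m * Delta_p m + x_b m * Delta_b m).

(* Main.v *)
(* Differentiating PHT gives PHT'(beta) = x_rs (t_B + toll(beta) - t_V), and the
   Beckmann potential with toll tau has derivative x_rs (t_B + tau - t_V).
   For tau = toll(beta_SO) the two derivatives agree at beta_SO, so the
   first-order condition for the (possibly nonconvex) minimisation of PHT is
   also the one for the Beckmann potential. The latter has a strictly increasing
   derivative, so the condition characterises its unique minimiser. *)
Require Import Defs.
From Stdlib Require Import Reals Lra.
From Coquelicot Require Import Coquelicot.
Open Scope R_scope.

(** * Optimality conditions on the unit interval *)

(** Otherwise a short move from [x] towards [y], which stays in [0,1], would strictly decrease [F].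
    Testing against every [y] treats interior and endpoint minimisers alike. *)
Lemma argmin01_first_order (F : R -> R) (x l : R) :
  is_argmin01 F x -> is_derive F x l ->
  forall y, 0 <= y <= 1 -> 0 <= l * (y - x).
Proof.
intros [Hx Hmin] HF y Hy.
apply Rnot_lt_le; intro Hneg.
assert (Hl : l <> 0) by (intro E; rewrite E in Hneg; lra).
apply is_derive_Reals in HF.
(* With tolerance [Rabs l], the difference quotient must have the sign of [l]. *)
destruct (HF (Rabs l) (Rabs_pos_lt _ Hl)) as [d Hd].
(* The bound 1 keeps [x + t * (y - x)] in [0,1]; the bound [d / 2] makes the step shorter than
   [d]. *)
set (t := Rmin 1 (d / 2)).
assert (Ht : 0 < t <= 1 /\ t < d).
{ pose proof (cond_pos d); unfold t, Rmin; destruct (Rle_dec 1 (d / 2)); lra. }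
set (h := t * (y - x)).
assert (Hlh : l * h < 0) by (unfold h; nra).
assert (Hh : h <> 0) by (intro E; rewrite E in Hlh; lra).
assert (Hhd : Rabs h < d).
{ unfold h; rewrite Rabs_mult, (Rabs_pos_eq t) by lra.
  assert (Rabs (y - x) <= 1) by (apply Rabs_le; lra).
  pose proof (Rabs_pos (y - x)); nra. }
specialize (Hd h Hh Hhd).
assert (Hge : F x <= F (x + h)) by (apply Hmin; unfold h; nra).
set (q := (F (x + h) - F x) / h) in Hd.
assert (Hq : q * h = F (x + h) - F x) by (unfold q; field; exact Hh).
revert Hd; unfold Rabs; destruct (Rcase_abs (q - l)), (Rcase_abs l); intro; nra.
Qed.

(** By the mean value theorem [F y - F x] is [g c * (y - x)] with [c] strictly between [x] and [y];
    strict monotonicity makes this exceed [g x * (y - x)], which is nonnegative. *)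
Lemma argmin01_of_increasing_derivative (F g : R -> R) (x : R) :
  (forall y, 0 <= y <= 1 -> is_derive F y (g y)) ->
  (forall y z, 0 <= y -> y < z -> z <= 1 -> g y < g z) ->
  0 <= x <= 1 ->
  (forall y, 0 <= y <= 1 -> 0 <= g x * (y - x)) ->
  forall y, is_argmin01 F y <-> y = x.
Proof.
intros HF Hg Hx Hfoc.
assert (Hlt : forall y, 0 <= y <= 1 -> y <> x -> F x < F y).
{ intros y Hy Hyx; specialize (Hfoc y Hy).
  destruct (Rtotal_order y x) as [Hl | [E | Hl]]; [ | contradiction | ].
  - destruct (MVT_cor2 F g y x Hl) as [c [E Hc]].
    { intros c Hc; apply is_derive_Reals, HF; lra. }
    assert (g c < g x) by (apply Hg; lra); nra.
  - destruct (MVT_cor2 F g x y Hl) as [c [E Hc]].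
    { intros c Hc; apply is_derive_Reals, HF; lra. }
    assert (g x < g c) by (apply Hg; lra); nra. }
intro y; split.
- intros [Hy Hmin]; destruct (Req_dec y x) as [E | Hne]; [exact E | ].
  specialize (Hlt y Hy Hne); specialize (Hmin x Hx); lra.
- intros ->; split; [exact Hx | ].
  intros y Hy; destruct (Req_dec y x) as [-> | Hne]; [lra | ].
  apply Rlt_le, Hlt; assumption.
Qed.

(** The margin [lo < 0] makes the derivative two-sided even at [x = 0], the demand reached when
    nobody pools or everybody does. *)
Lemma is_derive_RInt_0 (f : R -> R) (lo x : R) :
  lo < 0 -> lo < x -> (forall s, lo < s -> continuous f s) ->
  is_derive (fun u => RInt f 0 u) x (f x).
Proof.
intros Hlo Hx Hf.
apply (is_derive_RInt f (fun u => RInt f 0 u) 0 x); [ | exact (Hf x Hx)].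
assert (Hd : 0 < x - lo) by lra.
exists (mkposreal _ Hd); intros u Hu.
apply (RInt_correct f 0 u), (ex_RInt_continuous f 0 u).
intros z [Hz _]; apply Hf.
apply Rabs_lt_between' in Hu; simpl in Hu.
revert Hz; unfold Rmin; destruct (Rle_dec 0 u); lra.
Qed.

(** * Loads, delays and their derivatives *)

Section Delays.

Variables (m : model) (alpha : R).
Hypotheses (Hm : admissible m) (Halpha : 0 < alpha < 1).

Lemma capacity_V_gt0 : 0 < omega m * alpha * cap m.
Proof.
destruct (omega_range m Hm); pose proof (cap_gt0 m Hm).
repeat apply Rmult_lt_0_compat; lra.
Qed.

Lemma capacity_B_gt0 : 0 < (1 - alpha) * cap m.
Proof. pose proof (cap_gt0 m Hm); apply Rmult_lt_0_compat; lra. Qed.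

Lemma k_gt0 : 0 < k m.
Proof.
destruct (k_fun_bus_factor m Hm) as [_ [Hk _]].
apply Hk; pose proof (f_b_gt0 m Hm); lra.
Qed.

(** The load vanishes at the negative demand [- x_pv m], so zero demand is interior to the region
    where the power is smooth. *)
Lemma load_V_gt0 s : - x_pv m < s -> 0 < load_V m alpha s.
Proof. intro; apply Rdiv_lt_0_compat; [lra | apply capacity_V_gt0]. Qed.

Lemma load_B_gt0 s : - (o_p m * f_b m) < s -> 0 < load_B m alpha s.
Proof.
intro Hs; apply Rdiv_lt_0_compat; [ | apply capacity_B_gt0].
pose proof (o_p_gt1 m Hm).
replace (s / o_p m + f_b m) with ((s + o_p m * f_b m) / o_p m) by (field; lra).
apply Rdiv_lt_0_compat; lra.
Qed.

Lemma load_V_lt s1 s2 : s1 < s2 -> load_V m alpha s1 < load_V m alpha s2.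
Proof.
intro; apply Rmult_lt_compat_r; [apply Rinv_0_lt_compat, capacity_V_gt0 | lra].
Qed.

Lemma load_B_lt s1 s2 : s1 < s2 -> load_B m alpha s1 < load_B m alpha s2.
Proof.
intro; apply Rmult_lt_compat_r; [apply Rinv_0_lt_compat, capacity_B_gt0 | ].
apply Rplus_lt_compat_r, Rmult_lt_compat_r; [ | assumption].
apply Rinv_0_lt_compat; pose proof (o_p_gt1 m Hm); lra.
Qed.

Lemma is_derive_Rpower_load (load : R -> R) (c p s : R) :
  is_derive load s c -> 0 < load s ->
  is_derive (fun u => Rpower (load u) p) s
    (c * (p * Rpower (load s) (p - 1))).
Proof.
intros Hl Hp.
apply (is_derive_comp (fun v => Rpower v p) load); [ | exact Hl].
apply is_derive_Reals, derivable_pt_lim_power, Hp.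
Qed.

Definition marginal_V (s : R) : R :=
  t_f m * bpr_a m * bpr_b m * Rpower (load_V m alpha s) (bpr_b m - 1)
  / (omega m * alpha * cap m).

(** The detour factor is left out, so that pool and bus delays share this slope. *)
Definition marginal_B (s : R) : R :=
  t_f m * bpr_a m * bpr_b m * k m * Rpower (load_B m alpha s) (bpr_b m - 1)
  / (o_p m * (1 - alpha) * cap m).

Lemma is_derive_t_V s :
  - x_pv m < s -> is_derive (t_V m alpha) s (marginal_V s).
Proof.
intro Hs; pose proof capacity_V_gt0.
assert (HR : is_derive (fun u => Rpower (load_V m alpha u) (bpr_b m)) s
  (/ (omega m * alpha * cap m)
   * (bpr_b m * Rpower (load_V m alpha s) (bpr_b m - 1)))).
{ apply is_derive_Rpower_load; [ | apply load_V_gt0, Hs].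
  unfold load_V; auto_derive; [exact I | field].
  repeat split; intro E; rewrite E in *; lra. }
(* Naming the power lets [auto_derive] treat it as an abstract function, whose derivative is then
   supplied by [HR]. *)
unfold t_V; set (P := fun u => Rpower (load_V m alpha u) (bpr_b m)) in *.
change (is_derive (fun u => t_f m * (1 + bpr_a m * P u)) s (marginal_V s)).
auto_derive; [eexists; exact HR | ].
rewrite (is_derive_unique (fun u : R => P u) _ _ HR); unfold marginal_V, Rdiv; ring.
Qed.

Lemma is_derive_B_delay (D c s : R) :
  - (o_p m * f_b m) < s ->
  is_derive (fun u => t_f m * (1 + bpr_a m * Rpower (load_B m alpha u) (bpr_b m))
                      * D * k m + c) s (D * marginal_B s).
Proof.
intro Hs; pose proof capacity_B_gt0; pose proof (o_p_gt1 m Hm).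
pose proof (cap_gt0 m Hm).
assert (HR : is_derive (fun u => Rpower (load_B m alpha u) (bpr_b m)) s
  (/ (o_p m * (1 - alpha) * cap m)
   * (bpr_b m * Rpower (load_B m alpha s) (bpr_b m - 1)))).
{ apply is_derive_Rpower_load; [ | apply load_B_gt0, Hs].
  unfold load_B; auto_derive; [exact I | field; lra ]. }
set (P := fun u => Rpower (load_B m alpha u) (bpr_b m)) in *.
change (is_derive (fun u => t_f m * (1 + bpr_a m * P u) * D * k m + c) s
  (D * marginal_B s)).
auto_derive; [eexists; exact HR | ].
rewrite (is_derive_unique (fun u : R => P u) _ _ HR); unfold marginal_B, Rdiv; ring.
Qed.

Lemma is_derive_t_B s :
  - (o_p m * f_b m) < s ->
  is_derive (t_B m alpha) s (Delta_p m * marginal_B s).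
Proof.
intro Hs; eapply is_derive_ext; [ | exact (is_derive_B_delay (Delta_p m) 0 s Hs)].
intro u; unfold t_B; apply Rplus_0_r.
Qed.

Lemma is_derive_t_b s :
  - (o_p m * f_b m) < s ->
  is_derive (t_b m alpha) s (Delta_b m * marginal_B s).
Proof. exact (is_derive_B_delay (Delta_b m) (gamma m) s). Qed.

Lemma t_V_lt s1 s2 :
  - x_pv m < s1 -> s1 < s2 -> t_V m alpha s1 < t_V m alpha s2.
Proof.
intros H1 H12.
apply Rmult_lt_compat_l; [exact (t_f_gt0 m Hm) | ].
apply Rplus_lt_compat_l, Rmult_lt_compat_l; [exact (bpr_a_gt0 m Hm) | ].
apply Rlt_Rpower_l; [exact (bpr_b_gt0 m Hm) | ].
split; [apply load_V_gt0, H1 | apply load_V_lt, H12].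
Qed.

Lemma t_B_lt s1 s2 :
  - (o_p m * f_b m) < s1 -> s1 < s2 -> t_B m alpha s1 < t_B m alpha s2.
Proof.
intros H1 H12.
apply Rmult_lt_compat_r; [exact k_gt0 | ].
apply Rmult_lt_compat_r; [pose proof (Delta_p_gt1 m Hm); lra | ].
apply Rmult_lt_compat_l; [exact (t_f_gt0 m Hm) | ].
apply Rplus_lt_compat_l, Rmult_lt_compat_l; [exact (bpr_a_gt0 m Hm) | ].
apply Rlt_Rpower_l; [exact (bpr_b_gt0 m Hm) | ].
split; [apply load_B_gt0, H1 | apply load_B_lt, H12].
Qed.

(** * Derivatives of the two objectives *)

(** Keeping [tau] separate from [beta] lets one formula serve both objectives: a constant toll for
    [beckmann], a toll varying with [beta] for [PHT]. *)
Definition tolled_gap (tau beta : R) : R :=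
  x_rs m * (t_B m alpha (beta * x_rs m) + tau
            - t_V m alpha ((1 - beta) * x_rs m)).

Lemma demand_ranges beta :
  0 <= beta <= 1 ->
  - x_pv m < (1 - beta) * x_rs m /\ - (o_p m * f_b m) < beta * x_rs m.
Proof.
intro; pose proof (x_pv_gt0 m Hm); pose proof (x_rs_gt0 m Hm).
pose proof (o_p_gt1 m Hm); pose proof (f_b_gt0 m Hm); split; nra.
Qed.

(** More pooling loads the bus network and relieves the vehicle network, so both delay terms push
    the gap up. *)
Lemma tolled_gap_lt tau beta1 beta2 :
  0 <= beta1 -> beta1 < beta2 -> beta2 <= 1 ->
  tolled_gap tau beta1 < tolled_gap tau beta2.
Proof.
intros H1 H12 H2; pose proof (x_rs_gt0 m Hm) as Hrs.
apply Rmult_lt_compat_l; [exact Hrs | ].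
destruct (demand_ranges beta1) as [_ HB]; [lra | ].
destruct (demand_ranges beta2) as [HV _]; [lra | ].
assert (t_B m alpha (beta1 * x_rs m) < t_B m alpha (beta2 * x_rs m))
  by (apply t_B_lt; [exact HB | nra]).
assert (t_V m alpha ((1 - beta2) * x_rs m) < t_V m alpha ((1 - beta1) * x_rs m))
  by (apply t_V_lt; [exact HV | nra]).
lra.
Qed.

Lemma is_derive_PHT beta :
  0 <= beta <= 1 ->
  is_derive (PHT m alpha) beta (tolled_gap (pool_toll m alpha beta) beta).
Proof.
intro Hbeta; destruct (demand_ranges beta Hbeta) as [HsV HsB].
pose proof (is_derive_t_V _ HsV) as HV.
pose proof (is_derive_t_B _ HsB) as HB.
pose proof (is_derive_t_b _ HsB) as Hb.
pose proof (load_V_gt0 _ HsV) as HLV.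
pose proof capacity_V_gt0; pose proof capacity_B_gt0; pose proof (o_p_gt1 m Hm).
pose proof (cap_gt0 m Hm).
(* The demand over the capacity is one more factor of the load, raising the exponent from
   [bpr_b m - 1] to [bpr_b m]; hence the first term of the toll has no demand factor. *)
assert (HmV : (x_pv m + (1 - beta) * x_rs m) * marginal_V ((1 - beta) * x_rs m)
  = t_f m * bpr_a m * bpr_b m
    * Rpower (load_V m alpha ((1 - beta) * x_rs m)) (bpr_b m)).
{ replace (Rpower _ (bpr_b m))
    with (load_V m alpha ((1 - beta) * x_rs m)
          * Rpower (load_V m alpha ((1 - beta) * x_rs m)) (bpr_b m - 1)).
  - unfold marginal_V; set (P := Rpower _ _); unfold load_V, Rdiv; ring.
  - rewrite <- (Rpower_1 _ HLV) at 1; rewrite <- Rpower_plus; f_equal; ring. }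
(* The toll is the net external cost of shifting a user to pooling: delay added for pool and bus
   users, minus delay saved on the vehicle network. *)
assert (Htoll : pool_toll m alpha beta
  = - ((x_pv m + (1 - beta) * x_rs m) * marginal_V ((1 - beta) * x_rs m))
    + marginal_B (beta * x_rs m)
      * (beta * x_rs m * Delta_p m + x_b m * Delta_b m)).
{ rewrite HmV; unfold pool_toll, marginal_B, load_V, load_B.
  replace (beta * (x_rs m / o_p m)) with (beta * x_rs m / o_p m)
    by (unfold Rdiv; ring).
  unfold Rdiv; ring. }
unfold PHT; auto_derive.
- repeat split; eexists; eassumption.
- replace (1 + - beta) with (1 - beta) by ring.
  rewrite (is_derive_unique (fun x : R => t_V m alpha x) _ _ HV),
    (is_derive_unique (fun x : R => t_B m alpha x) _ _ HB),
    (is_derive_unique (fun x : R => t_b m alpha x) _ _ Hb).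
  unfold tolled_gap; rewrite Htoll; ring.
Qed.

Lemma is_derive_beckmann tau beta :
  0 <= beta <= 1 ->
  is_derive (beckmann m alpha tau) beta (tolled_gap tau beta).
Proof.
intro Hbeta; destruct (demand_ranges beta Hbeta) as [HsV HsB].
pose proof (x_pv_gt0 m Hm); pose proof (o_p_gt1 m Hm); pose proof (f_b_gt0 m Hm).
assert (HV : is_derive (fun u => RInt (fun s => t_V m alpha s) 0 u)
  ((1 - beta) * x_rs m) (t_V m alpha ((1 - beta) * x_rs m))).
{ apply (is_derive_RInt_0 _ (- x_pv m)); [lra | exact HsV | ].
  intros s Hs; apply (ex_derive_continuous (t_V m alpha)).
  eexists; apply is_derive_t_V, Hs. }
assert (HB : is_derive (fun u => RInt (fun s => t_B m alpha s + tau) 0 u)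
  (beta * x_rs m) (t_B m alpha (beta * x_rs m) + tau)).
{ apply (is_derive_RInt_0 (fun s => t_B m alpha s + tau) (- (o_p m * f_b m))); [nra | exact HsB | ].
  intros s Hs; apply (continuous_plus (t_B m alpha) (fun _ => tau));
    [ | apply continuous_const].
  apply (ex_derive_continuous (t_B m alpha)).
  eexists; apply is_derive_t_B, Hs. }
unfold beckmann.
set (IV := fun u => RInt (fun s => t_V m alpha s) 0 u) in HV.
set (IB := fun u => RInt (fun s => t_B m alpha s + tau) 0 u) in HB.
change (is_derive (fun x => IV ((1 - x) * x_rs m) + IB (x * x_rs m)) beta
  (tolled_gap tau beta)).
auto_derive.
- repeat split; eexists; eassumption.
- replace (1 + - beta) with (1 - beta) by ring.
  rewrite (is_derive_unique (fun x : R => IV x) _ _ HV),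
    (is_derive_unique (fun x : R => IB x) _ _ HB).
  unfold tolled_gap; ring.
Qed.

End Delays.

Theorem proposition6 (m : model) (alpha beta_SO tau_p : R)
  (Hm : admissible m)
  (Halpha : 0 < alpha < 1)
  (HSO : system_optimum m alpha beta_SO)
  (Htoll : tau_p = pool_toll m alpha beta_SO) :
  forall beta_UE : R,
    user_equilibrium m alpha tau_p beta_UE <-> beta_UE = beta_SO.
Proof.
assert (Hrange : 0 <= beta_SO <= 1) by apply HSO.
apply (argmin01_of_increasing_derivative _ (tolled_gap m alpha tau_p)).
- intros; apply is_derive_beckmann; assumption.
- intros; apply tolled_gap_lt; assumption.
- exact Hrange.
(* The value of the toll enters here: it turns the gap at [beta_SO] into the derivative of [PHT]
   there. *)
- rewrite Htoll; apply (argmin01_first_order (PHT m alpha)); [exact HSO | ].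
  apply is_derive_PHT; assumption.
Qed.
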